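(* Let $G$ be a simple graph on $n\ge 2$ vertices. Then $q_1(G)+q_1(\overline{G})\le 3n-4$. Equality holds if and only if $G$ is the star $K_{1,n-1}$.
   Context: $\overline{G}$ denotes the complement of $G$. For a graph $G$ with adjacency matrix $A(G)$ and diagonal degree matrix $D(G)$, $q_1(G)$ denotes the largest eigenvalue of the signless Laplacian matrix $Q(G)=A(G)+D(G)$. $K_{r,s}$ is the complete bipartite graph with parts of sizes $r$ and $s$.
   Formalization: The equality case is corrected to ''G or its complement is the star K_{1,n-1}'': the sum is unchanged under complementation, so equality also holds for the disjoint union of K_1 and K_{n-1}, which is not a star. *)

(* Defs.v *)
From HB Require Import structures.
From mathcomp Require Import all_boot all_order all_algebra.
From mathcomp Require Import all_classical all_reals.

Set Implicit Arguments.
Unset Strict Implicit.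
Unset Printing Implicit Defensive.

Import Order.TTheory GRing.Theory Num.Theory.
Local Open Scope classical_set_scope.
Local Open Scope ring_scope.

(* Simple graphs with vertex set {0, ..., n-1}. *)
Record sgraph (n : nat) := SGraph {
  adj : rel 'I_n;
  adj_sym : symmetric adj;
  adj_irrefl : irreflexive adj }.

Definition compl_rel n (G : sgraph n) : rel 'I_n :=
  fun x y => (x != y) && ~~ adj G x y.

Lemma compl_rel_sym n (G : sgraph n) : symmetric (compl_rel G).
Proof. by move=> x y; rewrite /compl_rel eq_sym adj_sym. Qed.

Lemma compl_rel_irrefl n (G : sgraph n) : irreflexive (compl_rel G).
Proof. by move=> x; rewrite /compl_rel eqxx. Qed.

Definition compl n (G : sgraph n) : sgraph n :=
  SGraph (compl_rel_sym G) (compl_rel_irrefl G).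

(* The parts of K_{r,s} are {0, ..., r-1} and {r, ..., r+s-1}. *)
Definition bip_rel r s : rel 'I_(r + s) :=
  fun x y => (x < r)%N != (y < r)%N.

Lemma bip_rel_sym r s : symmetric (@bip_rel r s).
Proof. by move=> x y; rewrite /bip_rel eq_sym. Qed.

Lemma bip_rel_irrefl r s : irreflexive (@bip_rel r s).
Proof. by move=> x; rewrite /bip_rel eqxx. Qed.

Definition complete_bipartite r s : sgraph (r + s) :=
  SGraph (@bip_rel_sym r s) (@bip_rel_irrefl r s).

Definition graph_iso n m (G : sgraph n) (H : sgraph m) : Prop :=
  exists2 f : 'I_n -> 'I_m,
    bijective f & forall x y, adj H (f x) (f y) = adj G x y.

Definition deg n (G : sgraph n) (x : 'I_n) : nat := #|[set y | adj G x y]%SET|.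

Definition adjmx (R : realType) n (G : sgraph n) : 'M[R]_n :=
  \matrix_(i, j) (adj G i j)%:R.

Definition degmx (R : realType) n (G : sgraph n) : 'M[R]_n :=
  diag_mx (\row_i (deg G i)%:R).

Definition signless_laplacian (R : realType) n (G : sgraph n) : 'M[R]_n :=
  adjmx R G + degmx R G.

(* The set of real eigenvalues of a real symmetric matrix of positive size is
   finite and nonempty, so for 0 < n this supremum is a maximum; for n = 0 it
   is the default value 0. *)
Definition q1 (R : realType) n (G : sgraph n) : R :=
  sup [set a : R | eigenvalue (signless_laplacian R G) a].

(* Main.v *)
Require Import Defs.
From mathcomp Require Import all_boot all_order all_algebra.
From mathcomp Require Import all_classical all_reals.
From mathcomp Require Import perm polyrcf zify ring lra.

(** Write [d v] for the degree of [v], [S v] for the sum of the degrees of its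
    neighbours and [m] for the number of edges.  The inequality is the sum,
    over [G] and its complement, of the bound

      q1(G) <= n - 2 + 2m / (n - 1),

    because the two graphs together have n(n-1)/2 edges.

    For this bound, take an eigenvector [x] for an eigenvalue [a > 0] and a
    vertex [v] where [|x v| / d v] is largest.  Reading the eigenvalue equation
    at [v] gives [a * d v <= d v ^ 2 + S v] ([eigenvalue_maximisers]), so it is
    enough to bound the right-hand side by [n - 2 + 2m / (n - 1)] times [d v].
    This is a count of edges around [v] ([degree_bound_slack]): the edges
    between the neighbours of [v] and its non-neighbours relate [S v] to the
    degrees of the non-neighbours, and therefore to [2m].

    Suppose that the bound is an equality and [n >= 3].  Then every maximiser
    [v] has zero slack in the edge count, and every neighbour of a maximiser is
    again a maximiser.  Zero slack at a vertex with a non-neighbour forces [G]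
    or its complement to be a star.  Otherwise a maximiser is adjacent to
    everything, so all vertices are maximisers and [G] is complete
    ([eigenvalue_bound_tight]).  A complete graph does not give equality in the
    sum, since its complement has no edges and the bound of the complement,
    which is [n - 2], is then strict.  Conversely [n] is an eigenvalue of the
    star and [2(n - 2)] one of its complement, and they add up to [3n - 4].
    For [n = 2] one of the two graphs is always a star. *)

Set Implicit Arguments.
Unset Strict Implicit.
Unset Printing Implicit Defensive.

Import Order.TTheory GRing.Theory Num.Theory.
Local Open Scope ring_scope.

(** * The edge count around a vertex, as arithmetic *)

(** The parameters stand for a vertex [v] of degree [d] with [k] other vertices
    not adjacent to it: [S] and [T] are the sums of the degrees of its neighbours
    and of its non-neighbours, and [e] is the number of edges between these two
    sets, so that [d + k] is [n - 1] and [d + S + T] is [2m].  With [a], [b] and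
    [c] the deficits of the three upper bounds in the hypotheses, the slack is

      d k (k - 1) + e (d - k) + d b + k a
        = d k (d - 1) + c (k - d) + d b + k a.

    The first form shows that it is nonnegative if [k <= d], the second if
    [d <= k], and the equality cases can be read off term by term. *)
Lemma degree_slack (d k S T e : nat) :
  (0 < d)%N -> (S <= d * d + e)%N -> (e <= T)%N -> (e <= d * k)%N ->
  exists2 s,
    (d * ((d + k - 1) * (d + k) + (d + S + T)) = (d + k) * (d * d + S) + s)%N &
    (0 < k)%N -> s = 0%N ->
    [/\ d = 1, S = k.+1 & T = k]%N \/ [/\ k = 1, S = d * d & T = 0]%N.
Proof.
case: d => // d _ /subnKC; set a := subn _ _ => ha /subnKC.
set b := subn _ _ => hb /subnKC; set c := subn _ _ => hc.
clearbody a b c; subst T.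
have hka : (k * (S + a) = k * (d.+1 * d.+1 + e))%N by rewrite ha.
(* From here on the degree is [d.+1]. *)
have [kd|dk] := leqP d.+1 k.
  have [j hj] : exists j, k = (d.+1 + j)%N by exists (k - d.+1)%N; lia.
  have hjc : (j * (e + c) = j * (d.+1 * k))%N by rewrite hc.
  exists (d.+1 * k * d + c * j + d.+1 * b + k * a)%N; first by subst k; lia.
  move=> k0 /eqP; rewrite !addn_eq0 !muln_eq0 -!andbA => /and4P[? ? ? ?].
  have d0 : d = 0%N by lia.
  subst d. have ? : b = 0%N by lia.
  have ? : a = 0%N by lia.
  subst a b. have [j0|j0] := posnP j; last by left; split; lia.
  have k1 : k = 1%N by lia.
  have [e0|e0] := posnP e; last by left; split; lia.
  by right; split; lia.
have [j hj] : exists j, d = (k + j)%N by exists (d - k)%N; lia.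
exists (d.+1 * k * (k - 1) + e * j.+1 + d.+1 * b + k * a)%N.
  case: k hj {dk} hka hc => [|k] hj hka hc; first by subst d; lia.
  by rewrite subn1 /=; subst d; lia.
move=> k0 /eqP; rewrite !addn_eq0 !muln_eq0 -!andbA => /and4P[? ? ? ?].
have k1 : k = 1%N by lia.
have ? : e = 0%N by lia.
have ? : b = 0%N by lia.
have ? : a = 0%N by lia.
by subst; right; split; lia.
Qed.

(** * Degree sums *)

Definition nbr_deg_sum n (G : sgraph n) (v : 'I_n) : nat :=
  (\sum_(u | adj G v u) deg G u)%N.

Definition deg_sum n (G : sgraph n) : nat := (\sum_v deg G v)%N.

Lemma degE n (G : sgraph n) v : deg G v = (\sum_w adj G v w)%N.
Proof.
by rewrite /deg -sum1dep_card big_mkcond; apply: eq_bigr => w _; case: adj.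
Qed.

Lemma deg_compl n (G : sgraph n) v : (deg G v + deg (compl G) v = n.-1)%N.
Proof.
rewrite !degE -big_split /= (bigD1 v) //= /compl_rel adj_irrefl eqxx add0n.
rewrite (eq_bigr (fun=> 1%N)) => [|w wv]; last by rewrite eq_sym wv; case: adj.
by rewrite sum1_card cardC1 card_ord.
Qed.

Lemma deg_sum_compl n (G : sgraph n) :
  (deg_sum G + deg_sum (compl G) = n * n.-1)%N.
Proof.
rewrite -big_split (eq_bigr (fun=> n.-1)) => [|v _]; last exact: deg_compl.
by rewrite sum_nat_const card_ord.
Qed.

Lemma deg_sum_split n (G : sgraph n) v :
  deg_sum G = (deg G v + nbr_deg_sum G v +
               \sum_(w | adj (compl G) v w) deg G w)%N.
Proof.
rewrite /deg_sum (bigD1 v) //= (bigID (adj G v)) /= addnA.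
congr (_ + _ + _)%N; apply: eq_bigl => w; last by rewrite /compl_rel eq_sym.
by case: eqVneq => [->|//]; rewrite adj_irrefl.
Qed.

(** The non-neighbours of [v], with [v] itself excluded, are its neighbours in
    the complement, which is why they are written with [compl]. *)
Definition cross_edges n (G : sgraph n) (v : 'I_n) : nat :=
  (\sum_(u | adj G v u) \sum_(w | adj (compl G) v w) adj G u w)%N.

Lemma cross_edges_le_mul n (G : sgraph n) v :
  (cross_edges G v <= deg G v * deg (compl G) v)%N.
Proof.
rewrite {1}/deg -sum1dep_card big_distrl /=; apply: leq_sum => u _.
rewrite mul1n /deg -sum1dep_card; apply: leq_sum => w _; exact: leq_b1.
Qed.

Lemma cross_edges_le_sum n (G : sgraph n) v :
  (cross_edges G v <= \sum_(w | adj (compl G) v w) deg G w)%N.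
Proof.
rewrite /cross_edges exchange_big /=; apply: leq_sum => w _.
rewrite degE [leqRHS](bigID (adj G v)) /=; apply: leq_trans (leq_addr _ _).
by apply: leq_sum => u _; rewrite adj_sym.
Qed.

(** A neighbour [u] of [v] has at most [deg G v] neighbours in the closed
    neighbourhood of [v], because [u] itself is not one of them; its other
    neighbours are counted by [cross_edges]. *)
Lemma nbr_deg_sum_le n (G : sgraph n) v :
  (nbr_deg_sum G v <= deg G v * deg G v + cross_edges G v)%N.
Proof.
rewrite {1}/deg -sum1dep_card big_distrl /= -big_split /=.
apply: leq_sum => u vu; rewrite mul1n.
rewrite [deg G u]degE (bigID (adj (compl G) v)) /= addnC leq_add2r.
have vv : ~~ adj (compl G) v v by rewrite adj_irrefl.
have uu : ~~ adj (compl G) v u by rewrite /= /compl_rel vu andbF.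
have uv : u != v by apply: contraTneq vu => ->; rewrite adj_irrefl.
rewrite (bigD1 u) //= adj_irrefl add0n.
rewrite [deg G v]degE [leqRHS](bigD1 u) //= vu.
rewrite [leqLHS](bigD1 v) /=; last by rewrite vv eq_sym.
rewrite adj_sym vu leq_add2l [leqRHS](bigD1 v) 1?eq_sym //= adj_irrefl add0n.
rewrite big_mkcond [leqRHS]big_mkcond /=; apply: leq_sum => w _.
rewrite /compl_rel [v == w]eq_sym.
by case: (w == u); case: (w == v) => //=; case: (adj G v w); case: (adj G u w).
Qed.

(** * Stars *)

Definition star_at n (G : sgraph n) (u : 'I_n) : Prop :=
  forall x y, adj G x y = ((x == u) != (y == u)).

(** Every vertex other than [u] is adjacent to [u] and so has degree at least 1;
    the degree sum leaves no room for more. *)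
Lemma star_at_of_degrees n (G : sgraph n) u :
  deg G u = n.-1 -> deg_sum G = (2 * n.-1)%N -> star_at G u.
Proof.
move=> du D; have univ w : w != u -> adj G u w.
  move=> wu; apply: contraT => nuw; have := deg_compl G u.
  rewrite du degE (bigD1 w) //= /compl_rel eq_sym wu nuw /=; lia.
have ge1 w : w != u -> (1 <= deg G w)%N.
  by move=> wu; rewrite degE (bigD1 u) //= adj_sym univ.
have eq1 w : w != u -> deg G w = 1%N.
  move=> wu; have [_] := leqif_sum (fun i iu => leqif_eq (ge1 i iu)).
  move: D; rewrite /deg_sum (bigD1 u) //= du mul2n -addnn => /addnI ->.
  rewrite sum1_card cardC1 card_ord eqxx => /esym/forall_inP/(_ w wu).
  by rewrite eq_sym => /eqP.
move=> x y; have [->|xu] := eqVneq x u; have [->|yu] := eqVneq y u => //=.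
- by rewrite adj_irrefl.
- exact: univ.
- by rewrite adj_sym univ.
- have := eq1 x xu; rewrite degE (bigD1 u) //= adj_sym univ // (bigD1 y) //=.
  by case: adj.
Qed.

(** In [complete_bipartite 1 n.-1] the centre is the vertex [0]; a
    transposition moves [u] there. *)
Lemma star_atP n (G : sgraph n) : (0 < n)%N ->
  graph_iso G (complete_bipartite 1 n.-1) <-> exists u, star_at G u.
Proof.
case: n G => // n G _; split=> [[f bf fG]|[u Gu]].
  have [g fK gK] := bf; exists (g ord0) => x y.
  have E z : (f z < 1)%N = (z == g ord0).
    by rewrite ltnS leqn0; exact: (can2_eq fK gK z ord0).
  by rewrite -fG /= /bip_rel !E.
exists (tperm u ord0 : 'I_n.+1 -> 'I_n.+1) => [|x y].
  by exists (tperm u ord0); exact: tpermK.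
have E z : ((tperm u ord0 z : nat) < 1)%N = (z == u).
  by rewrite ltnS leqn0 -[z == u](inj_eq (@perm_inj _ (tperm u ord0))) tpermL.
by rewrite /= /bip_rel Gu; congr (_ != _); exact: E.
Qed.

(** * Positive eigenvalues of the signless Laplacian *)

Lemma signless_laplacianE (R : realType) n (G : sgraph n) (x : 'rV[R]_n) j :
  (x *m signless_laplacian R G) 0 j =
  (deg G j)%:R * x 0 j + \sum_(i | adj G j i) x 0 i.
Proof.
rewrite mulmxDr /degmx mul_mx_diag !mxE addrC [x 0 j * _]mulrC; congr (_ + _).
rewrite [RHS]big_mkcond; apply: eq_bigr => i _; rewrite mxE adj_sym.
by case: adj; rewrite ?mulr1 ?mulr0.
Qed.

(** The predicate [P] selects the vertices where [|x i| / deg G i] attains its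
    maximum [M], for an eigenvector [x].  As [a] is not zero, [x] vanishes on
    isolated vertices, so the quotient is meaningful wherever it matters.  At
    such a vertex the eigenvalue equation and the bound [|x j| <= M * deg G j]
    give

      a M (deg G i) <= M (deg G i) ^ 2 + M (sum of the degrees next to i),

    and equality forces [|x j| = M * deg G j] for every neighbour [j]. *)
Lemma eigenvalue_maximisers (R : realType) n (G : sgraph n) (a : R) :
  0 < a -> eigenvalue (signless_laplacian R G) a ->
  exists P : pred 'I_n, (exists i, P i) /\
    forall i, P i ->
    [/\ (0 < deg G i)%N,
        a * (deg G i)%:R <= (deg G i * deg G i + nbr_deg_sum G i)%:R &
        a * (deg G i)%:R = (deg G i * deg G i + nbr_deg_sum G i)%:R ->
        forall j, adj G i j -> P j].
Proof.
move=> a_gt0 /eigenvalueP[x xQ x_neq0].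
have eqn j : a * x 0 j = (deg G j)%:R * x 0 j + \sum_(i | adj G j i) x 0 i.
  by rewrite -signless_laplacianE xQ mxE.
have isolated j : deg G j = 0%N -> x 0 j = 0.
  move=> dj; have := eqn j; rewrite dj mul0r add0r big1.
    by move/eqP; rewrite mulf_eq0 gt_eqF //= => /eqP.
  move=> i ji; move: dj; rewrite degE => /eqP; rewrite sum_nat_eq0.
  by move=> /forall_inP/(_ i isT); rewrite ji.
have [j0 xj0] : exists j, x 0 j != 0.
  apply/existsP; apply: contraNT x_neq0 => /existsPn x0.
  by apply/eqP/rowP => j; rewrite mxE; apply/eqP; rewrite -[_ == _]negbK.
pose r j := `|x 0 j| / (deg G j)%:R.
have [i _ imax] := @arg_maxP _ _ _ j0 predT r isT.
pose M := r i.
have le_M j : `|x 0 j| <= M * (deg G j)%:R.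
  have [dj|dj] := posnP (deg G j); first by rewrite isolated // dj normr0 mulr0.
  by rewrite -ler_pdivrMr ?ltr0n //; exact: imax.
have M_gt0 : 0 < M.
  rewrite lt_def divr_ge0 // andbT; apply: contraNneq xj0 => M0.
  by rewrite -normr_le0; apply: le_trans (le_M j0) _; rewrite M0 mul0r.
exists [pred j | (0 < deg G j)%N & `|x 0 j| == M * (deg G j)%:R].
have neq0 j : (0 < deg G j)%N -> (deg G j)%:R != 0 :> R.
  by rewrite pnatr_eq0 -lt0n.
split=> [|j /andP[dj /eqP xj]].
  exists i; rewrite /= lt0n; have [di|di] := eqVneq (deg G i) 0%N.
    by move: M_gt0; rewrite /M /r di invr0 mulr0 ltxx.
  by rewrite /M /r divfK ?neq0 ?eqxx ?lt0n.
have sum_M : \sum_(k | adj G j k) M * (deg G k)%:R = M * (nbr_deg_sum G j)%:R.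
  by rewrite -mulr_sumr -natr_sum.
have key : a * (M * (deg G j)%:R) <=
    (deg G j)%:R * (M * (deg G j)%:R) + \sum_(k | adj G j k) `|x 0 k|.
  rewrite -xj -[X in X * _ <= _](gtr0_norm a_gt0) -normrM eqn.
  apply: le_trans (ler_normD _ _) _; rewrite normrM normr_nat lerD2l.
  exact: ler_norm_sum.
have le_sum : \sum_(k | adj G j k) `|x 0 k| <= M * (nbr_deg_sum G j)%:R.
  by rewrite -sum_M; apply: ler_sum.
split=> // [|tight k jk].
  rewrite -(ler_pM2l M_gt0) natrD natrM.
  have := le_trans key (lerD (lexx _) le_sum); lra.
have dk : (0 < deg G k)%N by rewrite degE (bigD1 j) //= adj_sym jk.
rewrite /= dk eq_le le_M /=.
have : M * (nbr_deg_sum G j)%:R <= \sum_(k | adj G j k) `|x 0 k|.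
  move: tight; rewrite natrD natrM => tight.
  have : M * (a * (deg G j)%:R) =
    M * ((deg G j)%:R * (deg G j)%:R + (nbr_deg_sum G j)%:R) by rewrite tight.
  move: key; lra.
rewrite -sum_M (bigD1 k) //= [leRHS](bigD1 k) //=.
have : \sum_(i0 | adj G j i0 && (i0 != k)) `|x 0 i0| <=
       \sum_(i0 | adj G j i0 && (i0 != k)) M * (deg G i0)%:R by apply: ler_sum.
lra.
Qed.

(** * The bound on the eigenvalues *)

Definition q1_bound (R : realType) n (G : sgraph n) : R :=
  n%:R - 2 + (deg_sum G)%:R / n.-1%:R.

Lemma q1_bound_compl (R : realType) n (G : sgraph n) : (2 <= n)%N ->
  q1_bound R G + q1_bound R (compl G) = 3 * n%:R - 4.
Proof.
case: n G => [|[|n]] // G _; rewrite /q1_bound addrACA -mulrDl -natrD.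
by rewrite deg_sum_compl natrM mulfK ?pnatr_eq0 //=; ring.
Qed.

Lemma q1_bound_ge0 (R : realType) n (G : sgraph n) : (2 <= n)%N ->
  0 <= q1_bound R G.
Proof. by move=> n2; rewrite addr_ge0 ?divr_ge0 // subr_ge0 ler_nat. Qed.

Lemma q1_bound_gt0 (R : realType) n (G : sgraph n) : (3 <= n)%N ->
  0 < q1_bound R G.
Proof. by move=> n3; rewrite ltr_pwDl ?divr_ge0 // subr_gt0 ltr_nat. Qed.

Lemma sum_nbr1 n (G : sgraph n) v (F : 'I_n -> nat) :
  deg G v = 1%N -> exists u, (\sum_(w | adj G v w) F w = F u)%N.
Proof.
move=> /eqP/cards1P[u Nv]; exists u.
rewrite (eq_bigl (fun w => w \in [set u]%SET)) => [|w]; first exact: big_set1.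
by rewrite -Nv inE.
Qed.

(** The edge count in terms of [q1_bound].  In its two equality cases, either
    [v] is a leaf whose only neighbour is adjacent to all vertices, or the only
    non-neighbour of [v] is isolated; the degree sums then show that [G], in the
    first case, or its complement, in the second, is a star.  Multiplication by
    [n - 1] makes the slack a natural number. *)
Lemma degree_bound_slack (R : realType) n (G : sgraph n) v :
  (2 <= n)%N -> (0 < deg G v)%N ->
  exists2 s : nat,
    n.-1%:R * (q1_bound R G * (deg G v)%:R) =
      n.-1%:R * (deg G v * deg G v + nbr_deg_sum G v)%:R + s%:R &
    (0 < deg (compl G) v)%N -> s = 0%N ->
    (exists u, star_at G u) \/ (exists u, star_at (compl G) u).
Proof.
move=> n2 dv; have dk := deg_compl G v; have D := deg_sum_split G v.
have DC := deg_sum_compl G.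
have [s Es s0] := degree_slack dv (nbr_deg_sum_le G v)
  (cross_edges_le_sum G v) (cross_edges_le_mul G v).
exists s.
  rewrite -natrM -natrD; move: Es; rewrite -D dk => <-.
  rewrite /q1_bound subn1 natrM natrD natrM; move: (deg_sum G) => m.
  case: n n2 {G v dv dk D DC s0} (deg G v) m => [|[|n]] // _ d m.
  by rewrite /= -[n.+2%:R]natr1 -[n.+1%:R]natr1; field; rewrite natr1 pnatr_eq0.
move=> k0 /(s0 k0)[[d1 S1 T1]|[k1 S1 T1]].
  left; have [u Su] := sum_nbr1 (deg G) d1.
  exists u; apply: star_at_of_degrees; last by lia.
  by rewrite -Su; move: S1; rewrite /nbr_deg_sum; lia.
right; have [w Sw] := sum_nbr1 (deg G) k1.
exists w; apply: star_at_of_degrees.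
  by have := deg_compl G w; rewrite -Sw T1.
move: DC; rewrite D T1 S1; move: dk; rewrite k1; move: (deg G v) => d dk.
have [-> n1] : n.-1 = d.+1 /\ n = d.+2 by lia.
have /= := congr1 (fun m => m * d.+1)%N n1; lia.
Qed.

Lemma eigenvalue_le_bound (R : realType) n (G : sgraph n) (a : R) :
  (2 <= n)%N -> eigenvalue (signless_laplacian R G) a -> a <= q1_bound R G.
Proof.
move=> n2 ea; have [a0|a0] := leP a 0.
  exact: le_trans (q1_bound_ge0 R G n2).
have [P [[i Pi] /(_ i Pi)[di le_i _]]] := eigenvalue_maximisers a0 ea.
rewrite -(ler_pM2r (_ : 0 < (deg G i)%:R)) ?ltr0n //; apply: le_trans le_i _.
have [s Es _] := degree_bound_slack R n2 di.
have n1 : 0 < n.-1%:R :> R by rewrite ltr0n; lia.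
by rewrite -(ler_pM2l n1) Es lerDl.
Qed.

(** The maximisers all have zero slack and are closed under adjacency.  Unless
    one of them has a non-neighbour, they are adjacent to all vertices, so that
    every vertex is a maximiser. *)
Lemma eigenvalue_bound_tight (R : realType) n (G : sgraph n) :
  (3 <= n)%N -> eigenvalue (signless_laplacian R G) (q1_bound R G) ->
  [\/ exists u, star_at G u, exists u, star_at (compl G) u |
      forall v, deg G v = n.-1].
Proof.
move=> n3 ea; have n2 : (2 <= n)%N by lia.
have [P [[i Pi] Pmax]] := eigenvalue_maximisers (q1_bound_gt0 R G n3) ea.
have n1 : n.-1%:R != 0 :> R by rewrite pnatr_eq0; lia.
have tight j : P j ->
    [/\ (0 < deg G j)%N, forall k, adj G j k -> P k &
      (0 < deg (compl G) j)%N ->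
      (exists u, star_at G u) \/ (exists u, star_at (compl G) u)].
  move=> Pj; have [dj le_j cl_j] := Pmax j Pj.
  have [s Es s0] := degree_bound_slack R n2 dj.
  have n1' : 0 < n.-1%:R :> R by rewrite ltr0n; lia.
  have s_eq0 : s = 0%N.
    move: le_j; rewrite -(ler_pM2l n1') Es gerDl lern0; exact: eqP.
  split=> // [|k0]; last exact: s0.
  by apply: cl_j; apply: (mulfI n1); rewrite Es s_eq0 addr0.
have [[j Pj kj]|allP] := pselect (exists2 j, P j & (0 < deg (compl G) j)%N).
  by have [_ _ /(_ kj)[]] := tight j Pj; [constructor 1|constructor 2].
have full j : P j -> deg (compl G) j = 0%N.
  move=> Pj; apply/eqP; rewrite -leqn0 leqNgt; apply/negP => kj.
  by apply: allP; exists j.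
constructor 3 => v; have := deg_compl G v; rewrite full ?addn0 //.
have [->//|vi] := eqVneq v i; have [_ cl _] := tight i Pi; apply: cl.
have /eqP := full i Pi; rewrite degE sum_nat_eq0 => /forall_inP/(_ v isT).
by rewrite /= /compl_rel [i == v]eq_sym vi; case: adj.
Qed.

(** * From eigenvalues to the largest eigenvalue *)

(** The sign of [b] matters when the set of eigenvalues is empty, since its
    supremum is then [0] by convention; this spares proving that a symmetric
    matrix has a real eigenvalue. *)
Lemma q1_le (R : realType) n (G : sgraph n) (b : R) : 0 <= b ->
  (forall a, eigenvalue (signless_laplacian R G) a -> a <= b) -> q1 R G <= b.
Proof.
move=> b0 le_b; rewrite /q1; have [E0|] := pselect (nonempty
  (fun a => eigenvalue (signless_laplacian R G) a)); first exact: ge_sup.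
by move=> /nonemptyPn ->; rewrite sup0.
Qed.

(** A strict bound on the eigenvalues passes to their supremum because they are
    roots of the characteristic polynomial, hence finitely many. *)
Lemma q1_lt (R : realType) n (G : sgraph n) (b : R) : 0 < b ->
  (forall a, eigenvalue (signless_laplacian R G) a -> a < b) -> q1 R G < b.
Proof.
move=> b0 lt_b; pose p := char_poly (signless_laplacian R G).
have p0 : p != 0 by apply: monic_neq0; exact: char_poly_monic.
have rootsE a : (a \in rootsR p) = eigenvalue (signless_laplacian R G) a.
  by rewrite -(roots_on_rootsR p0) inE /= eigenvalue_root_char.
apply: (@le_lt_trans _ _ (\big[Order.max/0]_(a <- rootsR p) a)).
  apply: q1_le => [|a]; first exact: bigmax_ge_id.
  by rewrite -rootsE => ap; exact: le_bigmax_seq.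
by rewrite big_seq; apply: bigmax_lt => // a; rewrite rootsE => /lt_b.
Qed.

Lemma eigenvalue_le_q1 (R : realType) n (G : sgraph n) (a : R) : (2 <= n)%N ->
  eigenvalue (signless_laplacian R G) a -> a <= q1 R G.
Proof.
move=> n2 ea; apply: ub_le_sup => //; exists (q1_bound R G) => b.
exact: eigenvalue_le_bound.
Qed.

Lemma q1_le_bound (R : realType) n (G : sgraph n) :
  (2 <= n)%N -> q1 R G <= q1_bound R G.
Proof.
move=> n2; apply: q1_le => [|a]; first exact: q1_bound_ge0.
exact: eigenvalue_le_bound.
Qed.

Lemma q1_bound_attained (R : realType) n (G : sgraph n) : (3 <= n)%N ->
  q1 R G = q1_bound R G ->
  eigenvalue (signless_laplacian R G) (q1_bound R G).
Proof.
move=> n3 tight; apply: contraT => nev.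
have : q1 R G < q1_bound R G; last by rewrite tight ltxx.
apply: q1_lt => [|a ea]; first exact: q1_bound_gt0.
rewrite lt_def eigenvalue_le_bound ?(ltnW n3) // andbT.
by apply: contraNneq nev => ->.
Qed.

(** * Eigenvalues of the star and of its complement *)

Lemma star_deg n (G : sgraph n) u v : star_at G u ->
  deg G v = if v == u then n.-1 else 1%N.
Proof.
move=> Gu; rewrite degE; have [->|vu] := eqVneq v u.
  rewrite (bigD1 u) //= Gu eqxx (eq_bigr (fun=> 1%N)) => [|w wu].
    by rewrite sum1_card cardC1 card_ord.
  by rewrite Gu eqxx (negPf wu).
rewrite (bigD1 u) //= Gu eqxx (negPf vu) big1 // => w wu.
by rewrite Gu (negPf vu) (negPf wu).
Qed.

Lemma star_eigenvalue (R : realType) n (G : sgraph n) u : (2 <= n)%N ->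
  star_at G u -> eigenvalue (signless_laplacian R G) n%:R.
Proof.
move=> n2 Gu; apply/eigenvalueP.
exists (\row_j if j == u then n.-1%:R else 1).
  have n1 : n%:R = n.-1%:R + 1 :> R by rewrite natr1 prednK //; lia.
  apply/rowP => j; rewrite signless_laplacianE (star_deg _ Gu) !mxE n1.
  have [->|ju] := eqVneq j u.
    rewrite (eq_bigr (fun=> 1)) => [|w]; last first.
      by rewrite Gu eqxx mxE; case: (w == u).
    have -> : \sum_(w | adj G u w) (1 : R) = n.-1%:R.
      have := star_deg u Gu; rewrite eqxx => <-.
      by rewrite /deg -sum1dep_card natr_sum.
    ring.
  rewrite (bigD1 u) /=; last by rewrite Gu eqxx (negPf ju).
  rewrite mxE eqxx big1 => [|w /andP[]]; first by ring.
  by rewrite Gu (negPf ju) => /= /negPn ->.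
apply/eqP => /rowP/(_ u); rewrite !mxE eqxx => /eqP.
by rewrite pnatr_eq0; lia.
Qed.

(** The complement of a star is an isolated vertex and a complete graph on the
    other vertices, whose indicator function is an eigenvector. *)
Lemma co_star_eigenvalue (R : realType) n (G : sgraph n) u : (2 <= n)%N ->
  star_at (compl G) u ->
  eigenvalue (signless_laplacian R G) (2 * (n%:R - 2)).
Proof.
move=> n2 Gu.
have iso w : adj G u w = false.
  have := Gu u w; rewrite /= /compl_rel eqxx [u == w]eq_sym.
  by have [->|] := eqVneq w u; [rewrite adj_irrefl | case: adj].
have dG w : w != u -> deg G w = (n - 2)%N.
  move=> wu; have := deg_compl G w; rewrite (star_deg _ Gu) (negPf wu); lia.
apply/eigenvalueP; exists (\row_j (j != u)%:R).
  apply/rowP => j; rewrite signless_laplacianE !mxE.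
  have [->|ju] := eqVneq j u.
    by rewrite !mulr0 add0r big1 // => w; rewrite iso.
  rewrite (eq_bigr (fun=> 1)) => [|w jw]; last first.
    rewrite mxE; have [wu|//] := eqVneq w u.
    by rewrite wu adj_sym iso in jw.
  have -> : \sum_(w | adj G j w) (1 : R) = (deg G j)%:R.
    by rewrite /deg -sum1dep_card natr_sum.
  by rewrite dG // natrB //=; ring.
have [w wu] : exists w, w != u.
  have : (0 < #|predC1 u|)%N by rewrite cardC1 card_ord; lia.
  by case/card_gt0P => w; exists w.
by apply/eqP => /rowP/(_ w); rewrite !mxE wu => /eqP; rewrite oner_eq0.
Qed.

Lemma compl_star_at n (G : sgraph n) u :
  star_at G u -> star_at (compl (compl G)) u.
Proof.
move=> Gu x y; rewrite -Gu /= /compl_rel negb_and !negbK.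
by have [->|] := eqVneq x y; rewrite ?adj_irrefl.
Qed.

Lemma star_at_ord2 (G : sgraph 2) : star_at G ord0 \/ star_at (compl G) ord0.
Proof.
have two (H : sgraph 2) : adj H ord0 ord_max -> star_at H ord0.
  move=> H01 x y.
  have ord2 (z : 'I_2) : z = ord0 \/ z = ord_max.
    by case: z => [[|[|z]] Hz]; [left|right|]; try exact: val_inj.
  by case: (ord2 x) (ord2 y) => -> [] ->; rewrite ?adj_irrefl // adj_sym.
have [G01|nG01] := boolP (adj G ord0 ord_max); [left|right]; apply: two => //.
Qed.

Lemma q1_sum_star (R : realType) n (G : sgraph n) u : (2 <= n)%N ->
  star_at G u -> 3 * n%:R - 4 <= q1 R G + q1 R (compl G).
Proof.
move=> n2 Gu; have := eigenvalue_le_q1 n2 (star_eigenvalue R n2 Gu).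
have := eigenvalue_le_q1 n2 (co_star_eigenvalue R n2 (compl_star_at Gu)).
lra.
Qed.

Lemma q1_sum_co_star (R : realType) n (G : sgraph n) u : (2 <= n)%N ->
  star_at (compl G) u -> 3 * n%:R - 4 <= q1 R G + q1 R (compl G).
Proof.
move=> n2 Gu; have := eigenvalue_le_q1 n2 (star_eigenvalue R n2 Gu).
have := eigenvalue_le_q1 n2 (co_star_eigenvalue R n2 Gu).
lra.
Qed.

(** * The theorem *)

Theorem corollary20 (R : realType) (n : nat) (G : sgraph n) (n_ge2 : (2 <= n)%N) :
  q1 R G + q1 R (compl G) <= 3 * n%:R - 4 /\
  (q1 R G + q1 R (compl G) = 3 * n%:R - 4 <->
   graph_iso G (complete_bipartite 1 n.-1) \/
   graph_iso (compl G) (complete_bipartite 1 n.-1)).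
Proof.
have n_gt0 : (0 < n)%N by lia.
have bG := q1_le_bound R G n_ge2; have bC := q1_le_bound R (compl G) n_ge2.
have bsum := q1_bound_compl R G n_ge2.
have ub : q1 R G + q1 R (compl G) <= 3 * n%:R - 4 by rewrite -bsum lerD.
split=> //; rewrite !star_atP //; split=> [E|star]; last first.
  apply/eqP; rewrite eq_le ub /=; case: star => [[u]|[u]].
    exact: q1_sum_star.
  exact: q1_sum_co_star.
(* For [n = 2] every graph attains its bound, even the edgeless one, whose
   bound is [0]; the argument by maximisers needs a positive bound. *)
have [n2|n3] : n = 2 \/ (3 <= n)%N by lia.
  by move: G {bG bC bsum ub E}; rewrite n2 => G; have [] := star_at_ord2 G;
    [left|right]; exists ord0.
have tG : q1 R G = q1_bound R G by lra.
have tC : q1 R (compl G) = q1_bound R (compl G) by lra.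
have [||full] := eigenvalue_bound_tight n3 (q1_bound_attained n3 tG).
- by left.
- by right.
(* [G] is complete: the complement would need a maximiser of positive degree. *)
have dC v : deg (compl G) v = 0%N by have := deg_compl G v; rewrite full; lia.
have [P [[v Pv] /(_ v Pv)[]]] :=
  eigenvalue_maximisers (q1_bound_gt0 R _ n3) (q1_bound_attained n3 tC).
by rewrite dC.
Qed.
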